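(* The linear map $\psi:(\mathcal H_{\mathrm{int}},\spadesuit,\Delta_\bullet)\to(\mathcal H_{\mathrm{vinc}},\heartsuit,\Delta_\blacksquare)$ given on basis elements $\mathfrak s\in\mathbf{StIP}$ by $$\psi(\mathfrak s):=\sum_{\sigma\in\mathbf S_{|\bigcup\mathfrak s|}}(\mathfrak s,\sigma)$$ is an injective homomorphism of Hopf algebras.
   Context: $\mathbb N_{\ge1}=\{1,2,\dots\}$, $[n]=\{1,\dots,n\}$, $[0]=\emptyset$. For a finite set $A\subset\mathbb N_{\ge1}$, an interval partition of $A$ is a finite set $\mathcal I$ of non-empty pairwise disjoint sets (blocks) with union $A$, each block being an interval of $\mathbb N_{\ge1}$ (a set of consecutive integers $\{a,a+1,\dots,b\}$). $\mathbf{IP}(A)$ is the set of these ($\mathbf{IP}(\emptyset)=\{\emptyset\}$), $\mathbf{IP}=\bigcup_A\mathbf{IP}(A)$, and $\bigcup\mathcal I$ denotes the ground set of $\mathcal I$. $\mathbf{StIP}_n:=\mathbf{IP}([n])$, $\mathbf{StIP}:=\bigcup_{n\ge0}\mathbf{StIP}_n$. $\mathbf S_n$ is the symmetric group on $[n]$ ($\mathbf S_0$ contains only the empty permutation), permutations being written in one-line notation $\sigma=\sigma_1\cdots\sigma_n$. Standardization of partitions: for $\mathcal I\in\mathbf{IP}$ with $|\bigcup\mathcal I|=n$, $\mathbf{std}(\mathcal I)\in\mathbf{StIP}_n$ is the image of $\mathcal I$, block by block, under the unique order-preserving bijection $\bigcup\mathcal I\to[n]$. Standardization of permutations: for $\sigma\in\mathbf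 S_n$ and $A=\{a_1<\dots<a_k\}\subset[n]$ (positions), $\mathbf{st}(\sigma|_A)\in\mathbf S_k$ is the permutation with the same relative order as $\sigma_{a_1}\cdots\sigma_{a_k}$. Gluing: for $\mathcal I,\mathcal J\in\mathbf{IP}$, let $\sim$ be the smallest equivalence relation on the set of blocks $\mathcal I\cup\mathcal J$ such that $E\sim F$ whenever $E\cap F\neq\emptyset$. Then $\mathcal I\cdot_{\mathrm{glue}}\mathcal J:=\{\bigcup_{X\in[T]_\sim}X\mid T\in\mathcal I\cup\mathcal J\}$. Concatenations: $\mathfrak s\bullet\mathfrak t$ consists of the blocks of $\mathfrak s$ together with the blocks of $\mathfrak t$ translated by $|\bigcup\mathfrak s|$; $\sigma\,\square\,\tau:=\sigma_1\cdots\sigma_m(\tau_1+m)\cdots(\tau_n+m)$ for $\sigma\in\mathbf S_m,\tau\in\mathbf S_n$. $\mathcal H_{\mathrm{int}}$ is the free $\mathbb Q$-vector space on $\mathbf{StIP}$, with coproduct $\Delta_\bullet(\mathfrak s)=\sum_{\mathfrak a\bullet\mathfrak b=\mathfrak s}\mathfrak a\otimes\mathfrak b$ and product $\mathfrak s\spadesuit\mathfrak t:=\sum_{\mathfrak g}\langle\mathfrak s\otimes\mathfrak t,\Delta_\spadesuit(\mathfrak g)\rangle\mathfrak g$, where $\Delta_\spadesuit(\mathfrak g):=\sum_{A\cup A'=\bigcup\mathfrak g}\ \sum_{\mathcal I\in\mathbf{IP}(A),\,\mathcal I'\in\mathbf{IP}(A'),\ \mathcal I\cdot_{\mathrm{glue}}\mathcal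 I'=\mathfrak g}\mathbf{std}(\mathcal I)\otimes\mathbf{std}(\mathcal I')$ (outer sum over ordered pairs of not necessarily disjoint subsets). Its unit is $\emptyset\in\mathbf{StIP}_0$ and its counit is $1$ on $\emptyset$ and $0$ on the other basis elements. $\mathcal H_{\mathrm{vinc}}$ is the free $\mathbb Q$-vector space on $\bigcup_n\mathbf{StIP}_n\times\mathbf S_n$, with coproduct $\Delta_\blacksquare((\mathfrak s,\sigma)):=\sum(\mathfrak a,\alpha)\otimes(\mathfrak b,\beta)$, the sum over all basis elements $(\mathfrak a,\alpha),(\mathfrak b,\beta)$ with $\mathfrak a\bullet\mathfrak b=\mathfrak s$, $\alpha\,\square\,\beta=\sigma$, and product $(\mathfrak s,\sigma)\heartsuit(\mathfrak t,\tau):=\sum_{(\mathfrak g,\gamma)}\langle(\mathfrak s,\sigma)\otimes(\mathfrak t,\tau),\Delta_\heartsuit((\mathfrak g,\gamma))\rangle(\mathfrak g,\gamma)$, where $\Delta_\heartsuit((\mathfrak g,\gamma)):=\sum_{A\cup A'=\bigcup\mathfrak g}\ \sum_{\mathcal I\in\mathbf{IP}(A),\,\mathcal I'\in\mathbf{IP}(A'),\ \mathcal I\cdot_{\mathrm{glue}}\mathcal I'=\mathfrak g}(\mathbf{std}(\mathcal I),\mathbf{st}(\gamma|_A))\otimes(\mathbf{std}(\mathcal I'),\mathbf{st}(\gamma|_{A'}))$. Its unit is $(\emptyset,\text{empty permutation})$ and its counit is $1$ on this element and $0$ on the other basis elements. All pairings $\langle\cdot,\cdot\rangle$ make basis elements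 orthonormal. With these operations $\mathcal H_{\mathrm{int}}$ and $\mathcal H_{\mathrm{vinc}}$ are connected filtered Hopf algebras (filtered by the size $n$). *)

(* Defs.v *)
From HB Require Import structures.
From mathcomp Require Import all_boot all_order all_fingroup all_algebra.
From mathcomp Require Import finmap.
From mathcomp Require Import monalg.

Set Implicit Arguments.
Unset Strict Implicit.
Unset Printing Implicit Defensive.

Import GRing.Theory.
Local Open Scope ring_scope.

(* Positions and values 1, ..., n are represented by 0, ..., n - 1 : 'I_n. *)

Definition interval n (B : {set 'I_n}) : bool :=
  [exists a : 'I_n, exists b : 'I_n, B == [set x : 'I_n | a <= x <= b]%N].

(* [partition] already requires the blocks to be non-empty, pairwise disjoint
   and of union [A]. *)
Definition is_ip n (A : {set 'I_n}) (P : {set {set 'I_n}}) : bool :=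
  partition P A && [forall B in P, interval B].

Record IP n (A : {set 'I_n}) :=
  MkIP { blocks :> {set {set 'I_n}}; blocksP : is_ip A blocks }.

HB.instance Definition _ n A := [isSub for @blocks n A].
HB.instance Definition _ n A := [Finite of @IP n A by <:].

Notation StIP n := (IP [set: 'I_n]).

Definition stip : Type := {n : nat & StIP n}.
HB.instance Definition _ := Choice.on stip.

Definition vinc : Type := {n : nat & (StIP n * 'S_n)%type}.
HB.instance Definition _ := Choice.on vinc.

Definition meet_rel n (P Q : {set {set 'I_n}}) : rel {set 'I_n} :=
  fun E F => [&& E \in P :|: Q, F \in P :|: Q & E :&: F != set0].

(* [meet_rel P Q] is symmetric, so its reflexive transitive closure [connect]
   is the equivalence relation that it generates. *)
Definition glue n (P Q : {set {set 'I_n}}) : {set {set 'I_n}} :=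
  [set \bigcup_(X in P :|: Q | connect (meet_rel P Q) T X) X | T in P :|: Q].

Lemma ltn_enum_val n (A : {set 'I_n}) (i j : 'I_#|A|) :
  (enum_val i < enum_val j)%N = (i < j)%N.
Proof.
have srt : sorted ltn (map val (enum A)).
  have : subseq (map val (enum A)) (map val (enum 'I_n)).
    apply: map_subseq; rewrite !enumT /enum_mem; exact: filter_subseq.
  move=> h; apply: (subseq_sorted _ h); first exact: ltn_trans.
  by rewrite val_enum_ord iota_ltn_sorted.
have mono (k l : 'I_#|A|) : (k < l)%N -> (enum_val k < enum_val l)%N.
  move=> lt_kl; rewrite /enum_val.
  have sk : (k < size (enum A))%N by rewrite -cardE.
  have sl : (l < size (enum A))%N by rewrite -cardE.
  have := sorted_ltn_nth ltn_trans 0%N srt k l.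
  rewrite !inE size_map => /(_ sk sl lt_kl).
  by rewrite !(nth_map (enum_default k)) // (set_nth_default (enum_default l) _ sl).
apply/idP/idP; last exact: mono.
by apply: contraTT; rewrite -!leqNgt leq_eqVlt => /predU1P [/val_inj ->|/mono/ltnW].
Qed.

(* [enum_val : 'I_#|A| -> 'I_n] is the increasing enumeration of [A], so this is
   the image of [B] under the order-preserving bijection [A -> 'I_#|A|]. *)
Definition std_block n (A B : {set 'I_n}) : {set 'I_#|A|} :=
  [set i | enum_val i \in B].

Lemma std_subproof n (A : {set 'I_n}) (P : IP A) :
  is_ip [set: 'I_#|A|] [set std_block A B | B in blocks P].
Proof.
have /andP [/and3P [/eqP covP trivP n0P] /forall_inP intP] := blocksP P.
have sub B : B \in blocks P -> B \subset A.
  by move=> BP; rewrite -covP; apply: (bigcup_sup B).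
have ex B x : B \in blocks P -> x \in B -> exists2 i : 'I_#|A|, enum_val i = x & i \in std_block A B.
  move=> BP xB; have xA := subsetP (sub _ BP) _ xB.
  exists (enum_rank_in xA x); first by rewrite enum_rankK_in.
  by rewrite inE enum_rankK_in.
apply/andP; split; last first.
  apply/forall_inP => _ /imsetP [B BP ->].
  have /existsP [a /existsP [b /eqP defB]] := intP B BP.
  have [x0 x0B] : exists x, x \in B.
    by apply/set0Pn; apply: contraNneq n0P => <-.
  have leab : (a <= b)%N.
    by move: x0B; rewrite defB inE => /andP [/leq_trans h /h].
  have [i ia iB] : exists2 i : 'I_#|A|, enum_val i = a & i \in std_block A B.
    by apply: ex BP _; rewrite defB inE leqnn.
  have [j jb jB] : exists2 i : 'I_#|A|, enum_val i = b & i \in std_block A B.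
    by apply: ex BP _; rewrite defB inE leab leqnn.
  apply/existsP; exists i; apply/existsP; exists j.
  apply/eqP/setP => k; rewrite !inE {1}defB inE -ia -jb.
  by rewrite leqNgt ltn_enum_val -leqNgt [X in _ && X]leqNgt ltn_enum_val -leqNgt.
apply/and3P; split.
- apply/eqP/setP => i; rewrite inE; apply/bigcupP.
  have : enum_val i \in cover (blocks P) by rewrite covP enum_valP.
  by case/bigcupP => B BP iB; exists (std_block A B); rewrite ?inE ?imset_f.
- apply/trivIsetP => _ _ /imsetP [B BP ->] /imsetP [C CP ->] neq.
  have BC : B != C by apply: contraNneq neq => ->.
  have := trivIsetP trivP _ _ BP CP BC.
  rewrite -!setI_eq0 => /eqP BC0; apply/eqP/setP => i.
  by move/setP/(_ (enum_val i)): BC0; rewrite !inE.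
- apply/imsetP => -[B BP /setP h].
  have [x xB] : exists x, x \in B.
    by apply/set0Pn; apply: contraNneq n0P => <-.
  by have [i _] := ex B x BP xB; rewrite -h inE.
Qed.

Definition std n (A : {set 'I_n}) (P : IP A) : StIP #|A| :=
  MkIP (std_subproof P).

Section StPerm.
Variables (n : nat) (s : 'S_n) (A : {set 'I_n}).

Let below (i : 'I_#|A|) : {set 'I_#|A|} :=
  [set j | (s (enum_val j) < s (enum_val i))%N].

Let card_below i : (#|below i| < #|A|)%N.
Proof.
have : (#|below i| < #|[set: 'I_#|A|]|)%N.
  by apply/proper_card/properP; split; [exact: subsetT | exists i; rewrite !inE ?ltnn].
by rewrite cardsT card_ord.
Qed.

(* The value at [i] is the rank of the [i]-th letter of [s] at the positions in
   [A] among these letters. *)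
Definition st_fun (i : 'I_#|A|) : 'I_#|A| := Ordinal (card_below i).

Lemma ltn_st_fun i j :
  (st_fun i < st_fun j)%N = (s (enum_val i) < s (enum_val j))%N.
Proof.
have mono k l : (s (enum_val k) < s (enum_val l))%N -> (st_fun k < st_fun l)%N.
  move=> lt_kl; apply: proper_card; apply/properP; split.
    by apply/subsetP => m; rewrite !inE => /ltn_trans; apply.
  by exists k; rewrite !inE ?ltnn.
apply/idP/idP; last exact: mono.
apply: contraTT; rewrite -!leqNgt leq_eqVlt => /predU1P [e|/mono/ltnW //].
by rewrite (enum_val_inj (perm_inj (val_inj e))).
Qed.

Lemma st_fun_inj : injective st_fun.
Proof.
move=> i j eq_ij; apply/enum_val_inj/(@perm_inj _ s)/val_inj.
have h1 := ltn_st_fun i j; have h2 := ltn_st_fun j i.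
by move: h1 h2; rewrite eq_ij ltnn; case: ltngtP.
Qed.

Definition st : 'S_#|A| := perm st_fun_inj.

End StPerm.

Lemma bullet_subproof m n (s : StIP m) (t : StIP n) :
  is_ip [set: 'I_(m + n)]
    ([set lshift n @: B | B : {set 'I_m} in blocks s]
      :|: [set @rshift m n @: B | B : {set 'I_n} in blocks t]).
Proof.
have /andP [/and3P [/eqP covs trivs n0s] /forall_inP ints] := blocksP s.
have /andP [/and3P [/eqP covt trivt n0t] /forall_inP intt] := blocksP t.
apply/andP; split; last first.
  apply/forall_inP => _ /setUP [] /imsetP [B BP ->].
    have /existsP [a /existsP [b /eqP ->]] := ints B BP.
    apply/existsP; exists (lshift n a); apply/existsP; exists (lshift n b).
    apply/eqP/setP => x; rewrite inE; apply/imsetP/idP => [[y]|].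
      by rewrite inE => h ->.
    case: (split_ordP x) => y -> h; first by exists y; rewrite ?inE.
    by move: h => /= /andP [_] /leq_ltn_trans /(_ (ltn_ord b)); rewrite ltnNge leq_addr.
  have /existsP [a /existsP [b /eqP ->]] := intt B BP.
  apply/existsP; exists (rshift m a); apply/existsP; exists (rshift m b).
  apply/eqP/setP => x; rewrite inE; apply/imsetP/idP => [[y]|].
    by rewrite inE => h ->; rewrite /= !leq_add2l.
  case: (split_ordP x) => y -> h; last by exists y; rewrite ?inE //; move: h; rewrite /= !leq_add2l.
  by move: h => /= /andP [/leq_ltn_trans /(_ (ltn_ord y))]; rewrite ltnNge leq_addr.
have dis (B : {set 'I_m}) (C : {set 'I_n}) : [disjoint lshift n @: B & @rshift m n @: C].
  rewrite -setI_eq0; apply/eqP/setP => x; rewrite !inE.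
  by apply/negP => /andP [/imsetP [y _ ->] /imsetP [z _ /eqP]]; rewrite eq_lrshift.
apply/and3P; split.
- apply/eqP/setP => x; rewrite inE; apply/bigcupP.
  case: (split_ordP x) => y ->.
    have : y \in cover (blocks s) by rewrite covs inE.
    by case/bigcupP => B Bs yB; exists (lshift n @: B); rewrite ?inE ?imset_f.
  have : y \in cover (blocks t) by rewrite covt inE.
  by case/bigcupP => B Bs yB; exists (@rshift m n @: B); rewrite ?inE ?imset_f ?orbT.
- apply/trivIsetP => _ _ /setUP [] /imsetP [B BP ->] /setUP [] /imsetP [C CP ->] neq //.
  + have BC : B != C by apply: contraNneq neq => ->.
    by have := trivIsetP trivs _ _ BP CP BC; rewrite imset_disjoint //; exact: lshift_inj.
  + by rewrite disjoint_sym.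
  + have BC : B != C by apply: contraNneq neq => ->.
    by have := trivIsetP trivt _ _ BP CP BC; rewrite imset_disjoint //; exact: rshift_inj.
- rewrite inE negb_or; apply/andP; split; apply/imsetP => -[B BP /esym/eqP];
  by rewrite imset_eq0 => /eqP B0; move: n0s n0t; rewrite -?B0 BP.
Qed.

Definition bullet m n (s : StIP m) (t : StIP n) : StIP (m + n) :=
  MkIP (bullet_subproof s t).

Section Square.
Variables (m n : nat) (s : 'S_m) (t : 'S_n).

Definition square_fun (i : 'I_(m + n)) : 'I_(m + n) :=
  match split i with
  | inl j => lshift n (s j)
  | inr k => rshift m (t k)
  end.

Lemma square_fun_inj : injective square_fun.
Proof.
move=> i j; rewrite /square_fun -{2}(splitK i) -{2}(splitK j).
case: (split i) => a; case: (split j) => b //= /eqP.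
- by rewrite (inj_eq (@lshift_inj _ _)) => /eqP /perm_inj ->.
- by rewrite eq_lrshift.
- by rewrite eq_rlshift.
- by rewrite (inj_eq (@rshift_inj _ _)) => /eqP /perm_inj ->.
Qed.

Definition square : 'S_(m + n) := perm square_fun_inj.

End Square.

Definition stip_cat (a b : stip) : stip :=
  existT (fun n => StIP n) (tag a + tag b)%N (bullet (tagged a) (tagged b)).

Definition vinc_cat (a b : vinc) : vinc :=
  existT (fun n => (StIP n * 'S_n)%type) (tag a + tag b)%N
    (bullet (tagged a).1 (tagged b).1, square (tagged a).2 (tagged b).2).

(* [{malg rat[B]}] is the free vector space on [B], with basis elements [<< b >>]
   and coordinates [x@_b]; the tensor product of the free spaces on [B] and [C]
   is the free space on [B * C], with b (x) c = [<< (b, c) >>]. *)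

Section FreeSpaces.
Variables (B : choiceType) (V : lmodType rat) (f : B -> V).

Definition linext (x : {malg rat[B]}) : V :=
  \sum_(b <- msupp x) x@_b *: f b.

Lemma linextEw (d : {fset B}) (x : {malg rat[B]}) : (msupp x `<=` d)%fset ->
  linext x = \sum_(b <- d) x@_b *: f b.
Proof.
move=> le; rewrite /linext; apply: big_fset_incl => // b bd.
by rewrite -mcoeff_eq0 => /eqP ->; rewrite scale0r.
Qed.

Lemma linext_is_linear : linear linext.
Proof.
move=> c x y; pose d := (msupp (c *: x + y) `|` msupp x `|` msupp y)%fset.
have l1 : (msupp (c *: x + y) `<=` d)%fset by rewrite /d -fsetUA fsubsetUl.
have l2 : (msupp x `<=` d)%fset by rewrite /d fsetUAC fsubsetUr.
have l3 : (msupp y `<=` d)%fset by rewrite /d fsubsetUr.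
rewrite (linextEw l1) (linextEw l2) (linextEw l3) scaler_sumr -big_split /=.
by apply: eq_bigr => b _; rewrite mcoeffD mcoeffZ scalerDl scalerA.
Qed.

HB.instance Definition _ :=
  GRing.isLinear.Build rat {malg rat[B]} V *:%R linext linext_is_linear.

End FreeSpaces.

Definition pairing (B : choiceType) (x y : {malg rat[B]}) : rat :=
  \sum_(b <- msupp x) x@_b * y@_b.

Definition tensor (B C : choiceType) (x : {malg rat[B]}) (y : {malg rat[C]}) :
    {malg rat[(B * C)%type]} :=
  \sum_(b <- msupp x) \sum_(c <- msupp y) (x@_b * y@_c) *: << (b, c) >>.

Definition tensor_map (B B' C C' : choiceType)
    (f : {malg rat[B]} -> {malg rat[B']}) (g : {malg rat[C]} -> {malg rat[C']}) :
    {malg rat[(B * C)%type]} -> {malg rat[(B' * C')%type]} :=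
  linext (fun p => tensor (f << p.1 >>) (g << p.2 >>)).

(* The operations of a Hopf algebra whose underlying space is free on [hbasis],
   given on basis elements. *)
Record hopf_ops := HopfOps {
  hbasis : choiceType;
  hunit : {malg rat[hbasis]};
  hprod_basis : hbasis -> hbasis -> {malg rat[hbasis]};
  hcounit_basis : hbasis -> rat;
  hcoprod_basis : hbasis -> {malg rat[(hbasis * hbasis)%type]}
}.

Notation hspace H := {malg rat[hbasis H]}.
Notation hspace2 H := {malg rat[(hbasis H * hbasis H)%type]}.

Section Operations.
Variable H : hopf_ops.

Definition hmul : hspace2 H -> hspace H :=
  linext (fun p => hprod_basis p.1 p.2).

Definition hprod (x y : hspace H) : hspace H := hmul (tensor x y).

Definition hcounit : hspace H -> rat := linext (@hcounit_basis H : hbasis H -> rat^o).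

Definition hcoprod : hspace H -> hspace2 H := linext (@hcoprod_basis H).

Definition is_antipode (S : {linear hspace H -> hspace H}) : Prop :=
  forall x : hspace H,
    hmul (tensor_map S idfun (hcoprod x)) = hcounit x *: hunit H /\
    hmul (tensor_map idfun S (hcoprod x)) = hcounit x *: hunit H.

End Operations.

(* Antipodes are unique when they exist, so the last clause says that [f] commutes
   with the antipodes of [H] and [K]. *)
Record hopf_morphism (H K : hopf_ops) (f : {linear hspace H -> hspace K}) : Prop :=
  HopfMorphism {
    morphism_unit : f (hunit H) = hunit K;
    morphism_prod : forall x y, f (hprod x y) = hprod (f x) (f y);
    morphism_counit : forall x, hcounit (f x) = hcounit x;
    morphism_coprod : forall x, hcoprod (f x) = tensor_map f f (hcoprod x);
    morphism_antipode : forall S T, is_antipode S -> is_antipode T ->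
      forall x, f (S x) = T (f x)
  }.

Lemma empty_subproof : is_ip [set: 'I_0] set0.
Proof.
apply/andP; split; last by apply/forall_inP => B; rewrite inE.
apply/and3P; split.
- by apply/eqP/setP => i; have := ltn_ord i.
- by apply/trivIsetP => A B; rewrite inE.
- by rewrite inE.
Qed.

Definition stip0 : stip := existT (fun n => StIP n) 0%N (MkIP empty_subproof).

(* By [stip_cat_bounded], bounding the sizes of [a] and [b] loses no pair of
   basis elements. *)
Definition coprod_bullet (s : stip) : {malg rat[(stip * stip)%type]} :=
  \sum_(m < (tag s).+1) \sum_(a : StIP m)
  \sum_(n < (tag s).+1) \sum_(b : StIP n | stip_cat (Tagged _ a) (Tagged _ b) == s)
    << (Tagged _ a : stip, Tagged _ b : stip) >>.

Definition coprod_spade (g : stip) : {malg rat[(stip * stip)%type]} :=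
  \sum_(A : {set 'I_(tag g)}) \sum_(A' : {set 'I_(tag g)} | A :|: A' == setT)
  \sum_(P : IP A) \sum_(P' : IP A' | glue P P' == tagged g)
    << (Tagged _ (std P) : stip, Tagged _ (std P') : stip) >>.

(* By [coprod_spade_bounded], the coefficient vanishes for larger [g]. *)
Definition prod_spade (s t : stip) : {malg rat[stip]} :=
  \sum_(n < (tag s + tag t).+1) \sum_(g : StIP n)
    pairing << (s, t) >> (coprod_spade (Tagged _ g)) *: << Tagged _ g : stip >>.

Definition Hint : hopf_ops := {|
  hbasis := stip;
  hunit := << stip0 >>;
  hprod_basis := prod_spade;
  hcounit_basis := fun s => (s == stip0)%:R;
  hcoprod_basis := coprod_bullet
|}.

Definition vinc0 : vinc :=
  existT (fun n => (StIP n * 'S_n)%type) 0%N (MkIP empty_subproof, 1%g).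

(* Equality in [vinc] of the pair [vinc_cat a b] with [s] is the conjunction
   of the conditions on the partitions and on the permutations. *)
Definition coprod_square (s : vinc) : {malg rat[(vinc * vinc)%type]} :=
  \sum_(m < (tag s).+1) \sum_(a : StIP m * 'S_m)
  \sum_(n < (tag s).+1) \sum_(b : StIP n * 'S_n | vinc_cat (Tagged _ a) (Tagged _ b) == s)
    << (Tagged _ a : vinc, Tagged _ b : vinc) >>.

Definition coprod_heart (g : vinc) : {malg rat[(vinc * vinc)%type]} :=
  \sum_(A : {set 'I_(tag g)}) \sum_(A' : {set 'I_(tag g)} | A :|: A' == setT)
  \sum_(P : IP A) \sum_(P' : IP A' | glue P P' == (tagged g).1)
    << (Tagged _ (std P, st (tagged g).2 A) : vinc,
        Tagged _ (std P', st (tagged g).2 A') : vinc) >>.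

Definition prod_heart (s t : vinc) : {malg rat[vinc]} :=
  \sum_(n < (tag s + tag t).+1) \sum_(g : StIP n * 'S_n)
    pairing << (s, t) >> (coprod_heart (Tagged _ g)) *: << Tagged _ g : vinc >>.

Definition Hvinc : hopf_ops := {|
  hbasis := vinc;
  hunit := << vinc0 >>;
  hprod_basis := prod_heart;
  hcounit_basis := fun s => (s == vinc0)%:R;
  hcoprod_basis := coprod_square
|}.

Lemma stip_cat_bounded (a b s : stip) :
  stip_cat a b = s -> (tag a <= tag s)%N /\ (tag b <= tag s)%N.
Proof. by move=> <-; rewrite leq_addr leq_addl. Qed.

Lemma vinc_cat_bounded (a b s : vinc) :
  vinc_cat a b = s -> (tag a <= tag s)%N /\ (tag b <= tag s)%N.
Proof. by move=> <-; rewrite leq_addr leq_addl. Qed.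

Lemma card_cover2 n (A A' : {set 'I_n}) :
  A :|: A' = setT -> (n <= #|A| + #|A'|)%N.
Proof.
by move=> AA'; rewrite -[leqLHS]card_ord -cardsT -AA' cardsU leq_subr.
Qed.

Lemma pairing_basis (B : choiceType) (b : B) (x : {malg rat[B]}) :
  pairing << b >> x = x@_b.
Proof. by rewrite /pairing msuppU oner_eq0 big_seq_fset1 mcoeffUU mul1r. Qed.

Lemma coprod_spade_bounded (g s t : stip) :
  pairing << (s, t) >> (coprod_spade g) != 0 -> (tag g <= tag s + tag t)%N.
Proof.
apply: contraNT; rewrite -ltnNge pairing_basis => lt_st.
rewrite /coprod_spade raddf_sum big1 //= => A _.
rewrite raddf_sum big1 //= => A' /eqP AA'.
rewrite raddf_sum big1 //= => P _; rewrite raddf_sum big1 //= => P' _.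
rewrite mcoeffU; case: eqP => // -[es et]; have := card_cover2 AA'.
by move: lt_st; rewrite -es -et /= ltnNge => /negP.
Qed.

Lemma coprod_heart_bounded (g s t : vinc) :
  pairing << (s, t) >> (coprod_heart g) != 0 -> (tag g <= tag s + tag t)%N.
Proof.
apply: contraNT; rewrite -ltnNge pairing_basis => lt_st.
rewrite /coprod_heart raddf_sum big1 //= => A _.
rewrite raddf_sum big1 //= => A' /eqP AA'.
rewrite raddf_sum big1 //= => P _; rewrite raddf_sum big1 //= => P' _.
rewrite mcoeffU; case: eqP => // -[es et]; have := card_cover2 AA'.
by move: lt_st; rewrite -es -et /= ltnNge => /negP.
Qed.

Definition psi_basis (s : stip) : {malg rat[vinc]} :=
  \sum_(g : 'S_(tag s)) << Tagged _ (tagged s, g) : vinc >>.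

Definition psi : {linear hspace Hint -> hspace Hvinc} := linext psi_basis.

(* Main.v *)
Require Import Defs.
From HB Require Import structures.
From mathcomp Require Import all_boot all_fingroup all_algebra.
From mathcomp Require Import finmap monalg.

Set Implicit Arguments.
Unset Strict Implicit.
Unset Printing Implicit Defensive.

Import GRing.Theory.
Local Open Scope ring_scope.

(* The coefficient of [psi x] at [(g, gamma)] is that of [x] at [g], since exactly
   one term of the sum defining [psi g] matches [gamma]; so [psi] is injective, and
   its compatibility with products and coproducts is a comparison of coefficients.
   For the antipodes S, T, both psi o S and T o psi are right convolution inverses
   of psi. As psi sends the empty partition to the unit of Hvinc, a right inverse is
   determined by induction on the size, by the term (empty) (x) s of the coproduct
   of s; no associativity of the product of Hvinc is needed. *)

(** * Linear maps and tensors on free spaces *)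

Section FreeSpaces.
Variables (B : choiceType) (V : lmodType rat).
Implicit Types f g : {linear {malg rat[B]} -> V}.

Lemma malg_basisE (x : {malg rat[B]}) : x = \sum_(b <- msupp x) x@_b *: << b >>.
Proof.
rewrite {1}[x]monalgE; apply: eq_bigr => b _.
by apply/malgP => c; rewrite mcoeffZ !mcoeffU mulr_natr.
Qed.

Lemma linear_basisE f x : f x = \sum_(b <- msupp x) x@_b *: f << b >>.
Proof.
by rewrite {1}[x]malg_basisE linear_sum; apply: eq_bigr => b _; rewrite linearZ.
Qed.

Lemma linear_eq_basis f g : (forall b, f << b >> = g << b >>) -> f =1 g.
Proof.
by move=> fg x; rewrite !linear_basisE; apply: eq_bigr => b _; rewrite fg.
Qed.

Lemma linextU (f : B -> V) b : linext f << b >> = f b.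
Proof. by rewrite /linext msuppU oner_eq0 big_seq_fset1 mcoeffUU scale1r. Qed.

End FreeSpaces.

Lemma mcoeff_basis (B : choiceType) (b c : B) :
  (<< b >> : {malg rat[B]})@_c = (b == c)%:R.
Proof. by rewrite mcoeffU. Qed.

Lemma sum_msupp_delta (B : choiceType) (x : {malg rat[B]}) b :
  \sum_(c <- msupp x) x@_c * (c == b)%:R = x@_b.
Proof.
rewrite [in RHS](malg_basisE x) raddf_sum /=; apply: eq_bigr => c _.
by rewrite mcoeffZ mcoeff_basis.
Qed.

Section Tensor.
Variables B C : choiceType.
Implicit Types (x : {malg rat[B]}) (y : {malg rat[C]}).

Lemma mcoeff_tensor x y b c : (tensor x y)@_(b, c) = x@_b * y@_c.
Proof.
rewrite /tensor raddf_sum /= -[x@_b]sum_msupp_delta mulr_suml.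
apply: eq_bigr => b' _; rewrite raddf_sum -[y@_c]sum_msupp_delta mulr_sumr /=.
apply: eq_bigr => c' _; rewrite mcoeffZ mcoeff_basis xpair_eqE -mulnb natrM.
by rewrite mulrACA.
Qed.

Lemma tensorU b c : tensor << b >> << c >> = << (b, c) >> :> {malg rat[(B * C)%type]}.
Proof.
apply/malgP => -[b' c']; rewrite mcoeff_tensor !mcoeff_basis xpair_eqE -natrM.
by rewrite mulnb.
Qed.

Lemma tensor_suml I (r : seq I) (F : I -> {malg rat[B]}) y :
  tensor (\sum_(i <- r) F i) y = \sum_(i <- r) tensor (F i) y.
Proof.
apply/malgP => -[b c]; rewrite mcoeff_tensor !raddf_sum mulr_suml.
by apply: eq_bigr => i _; rewrite /= mcoeff_tensor.
Qed.

Lemma tensor_sumr I (r : seq I) x (F : I -> {malg rat[C]}) :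
  tensor x (\sum_(i <- r) F i) = \sum_(i <- r) tensor x (F i).
Proof.
apply/malgP => -[b c]; rewrite mcoeff_tensor !raddf_sum mulr_sumr.
by apply: eq_bigr => i _; rewrite /= mcoeff_tensor.
Qed.

Lemma tensorZ a b x y : tensor (a *: x) (b *: y) = (a * b) *: tensor x y.
Proof.
apply/malgP => -[b' c']; rewrite mcoeffZ !mcoeff_tensor !mcoeffZ.
by rewrite mulrACA.
Qed.

Lemma tensorr0 x : tensor x (0 : {malg rat[C]}) = 0.
Proof. by apply/malgP => -[b c]; rewrite mcoeff_tensor !mcoeff0 mulr0. Qed.

Lemma tensorBr x y1 y2 : tensor x (y1 - y2) = tensor x y1 - tensor x y2.
Proof.
by apply/malgP => -[b c]; rewrite mcoeffB !mcoeff_tensor mcoeffB mulrBr.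
Qed.

Lemma tensor_basisE x y :
  tensor x y = \sum_(b <- msupp x) \sum_(c <- msupp y)
    (x@_b * y@_c) *: tensor << b >> << c >>.
Proof. by apply: eq_bigr => b _; apply: eq_bigr => c _; rewrite tensorU. Qed.

End Tensor.

Section TensorMap.
Variables B B' C C' : choiceType.

HB.instance Definition _ (f : {malg rat[B]} -> {malg rat[B']})
  (g : {malg rat[C]} -> {malg rat[C']}) :=
  GRing.Linear.copy (tensor_map f g)
    (linext (fun p => tensor (f << p.1 >>) (g << p.2 >>))).

Lemma tensor_mapU (f : {malg rat[B]} -> {malg rat[B']})
    (g : {malg rat[C]} -> {malg rat[C']}) p :
  tensor_map f g << p >> = tensor (f << p.1 >>) (g << p.2 >>).
Proof. exact: linextU. Qed.

Variables (f : {linear {malg rat[B]} -> {malg rat[B']}})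
          (g : {linear {malg rat[C]} -> {malg rat[C']}}).

Lemma tensor_map_tensor x y : tensor_map f g (tensor x y) = tensor (f x) (g y).
Proof.
rewrite [tensor x y]tensor_basisE (linear_basisE f) (linear_basisE g).
rewrite linear_sum tensor_suml; apply: eq_bigr => b _.
rewrite linear_sum tensor_sumr; apply: eq_bigr => c _.
by rewrite linearZ /= tensorU tensor_mapU tensorZ.
Qed.

End TensorMap.

Lemma tensor_map_comp (B1 B2 B3 C1 C2 C3 : choiceType)
    (f : {linear {malg rat[B2]} -> {malg rat[B3]}})
    (g : {linear {malg rat[C2]} -> {malg rat[C3]}})
    (f' : {malg rat[B1]} -> {malg rat[B2]})
    (g' : {malg rat[C1]} -> {malg rat[C2]}) z :
  tensor_map f g (tensor_map f' g' z) = tensor_map (f \o f') (g \o g') z.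
Proof.
pose l : {linear _ -> _} := tensor_map f g \o tensor_map f' g'.
apply: (linear_eq_basis (f := l) (g := tensor_map (f \o f') (g \o g'))) => p.
by rewrite /l /= !tensor_mapU tensor_map_tensor.
Qed.

(** * The Hopf operations and [psi] in coordinates *)

HB.instance Definition _ (H : hopf_ops) :=
  GRing.Linear.copy (@hmul H) (linext (fun p => @hprod_basis H p.1 p.2)).

HB.instance Definition _ (H : hopf_ops) :=
  GRing.Linear.copy (@hcoprod H) (linext (@hcoprod_basis H)).

HB.instance Definition _ (H : hopf_ops) :=
  GRing.Linear.copy (@hcounit H) (linext (@hcounit_basis H : hbasis H -> rat^o)).

Lemma hmulU (H : hopf_ops) p : @hmul H << p >> = hprod_basis p.1 p.2.
Proof. exact: linextU. Qed.

Lemma hcoprodU (H : hopf_ops) b : @hcoprod H << b >> = hcoprod_basis b.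
Proof. exact: linextU. Qed.

Lemma hcounitU (H : hopf_ops) b : @hcounit H << b >> = hcounit_basis b.
Proof. exact: (@linextU _ rat^o). Qed.

(** The second hypothesis covers the case where the size of [x] lies outside the truncated range:
    the sum is then empty of nonzero terms, and [F x] has to vanish too. *)
Lemma sum_tagged_pick (T : nat -> finType) (V : nmodType) N
    (F : {n & T n} -> V) x :
  (forall y, y <> x -> F y = 0) -> ((N <= tag x)%N -> F x = 0) ->
  \sum_(n < N) \sum_(a : T n) F (Tagged T a) = F x.
Proof.
case: x => n a F0 Fx; have [leNn|ltnN] := leqP N n.
  rewrite (Fx leNn) big1 // => m _; rewrite big1 // => b _.
  by apply: F0 => /(congr1 tag) /= mn; have := ltn_ord m; rewrite mn ltnNge leNn.
rewrite (bigD1 (Ordinal ltnN)) //= (bigD1 a) //= big1 ?addr0 => [|b ba].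
  rewrite big1 ?addr0 // => m mn; rewrite big1 // => b _.
  apply: F0 => /(congr1 tag) /= em; move/eqP: mn; apply.
  exact: val_inj.
by apply: F0 => /eqP; rewrite eq_Tagged /= (negPf ba).
Qed.

Definition stip_of (C : vinc) : stip := Tagged (fun n => StIP n) (tagged C).1.

(** If [C] lies over [s], its own permutation is the only one that matches. Read from right to left,
    this turns a coefficient in [Hint] into a sum over permutations. *)
Lemma sum_vinc_fiber (s : stip) (C : vinc) :
  \sum_(g : 'S_(tag s))
     (Tagged (fun n => (StIP n * 'S_n)%type) (tagged s, g) == C)%:R
  = (stip_of C == s)%:R :> rat.
Proof.
case: C => n [P c]; case: (stip_of _ =P s) => [<-|ne] /=.
  rewrite (bigD1 c) //= eqxx big1 ?addr0 // => g gc.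
  by rewrite -tag_eqE /tag_eq /= eqxx tagged_asE xpair_eqE (negPf gc) andbF.
rewrite big1 // => g _; case: eqP => // e; case: ne.
by rewrite -e /stip_of /=; case: (s).
Qed.

Lemma psiU s : psi << s >> = psi_basis s.
Proof. exact: linextU. Qed.

Lemma mcoeff_psi x C : (psi x)@_C = x@_(stip_of C).
Proof.
rewrite linear_basisE raddf_sum /= -[RHS]sum_msupp_delta.
apply: eq_bigr => s _; rewrite mcoeffZ psiU raddf_sum /= eq_sym.
rewrite -sum_vinc_fiber; congr (_ * _); apply: eq_bigr => g _.
by rewrite mcoeff_basis.
Qed.

Lemma mcoeff_tensor_map_psi z C D :
  (tensor_map psi psi z)@_(C, D) = z@_(stip_of C, stip_of D).
Proof.
rewrite linear_basisE raddf_sum /= -[RHS]sum_msupp_delta.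
apply: eq_bigr => -[s t] _; rewrite mcoeffZ tensor_mapU mcoeff_tensor !mcoeff_psi.
by rewrite !mcoeff_basis xpair_eqE -mulnb natrM.
Qed.

Section TaggedSums.
Variable T : nat -> finType.
Local Notation B := {n & T n}.

(** Treats both coproducts at once. The size bound guarantees that the truncated sums still meet
    both components of [p] whenever they concatenate to [s]. *)
Lemma mcoeff_sum_cat (cat : B -> B -> B) (s : B) p :
    (forall a b, cat a b = s -> (tag a <= tag s)%N /\ (tag b <= tag s)%N) ->
  (\sum_(m < (tag s).+1) \sum_(a : T m)
   \sum_(n < (tag s).+1) \sum_(b : T n | cat (Tagged T a) (Tagged T b) == s)
     << (Tagged T a, Tagged T b) >> : {malg rat[(B * B)%type]})@_p
  = (cat p.1 p.2 == s)%:R.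
Proof.
case: p => a b bnd /=; rewrite raddf_sum /=.
under eq_bigr do rewrite raddf_sum /=.
pose F c := \sum_(n < (tag s).+1) \sum_(d : T n | cat c (Tagged T d) == s)
  (<< (c, Tagged T d) >> : {malg rat[(B * B)%type]})@_(a, b).
transitivity (F a).
  rewrite -(@sum_tagged_pick T _ (tag s).+1 F a).
  - by apply: eq_bigr => m _; apply: eq_bigr => c _; rewrite raddf_sum;
       apply: eq_bigr => n _; rewrite raddf_sum.
  - move=> c /eqP/negPf ca; rewrite /F big1 // => n _; rewrite big1 // => d _.
    by rewrite mcoeff_basis xpair_eqE ca.
  - move=> lt; rewrite /F big1 // => n _; rewrite big1 // => d /eqP /bnd [].
    by rewrite leqNgt lt.
pose G d : rat := (cat a d == s)%:R * (d == b)%:R.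
transitivity (G b); last by rewrite /G eqxx mulr1.
rewrite -(@sum_tagged_pick T _ (tag s).+1 G b).
- apply: eq_bigr => n _; rewrite big_mkcond; apply: eq_bigr => d _ /=.
  rewrite mcoeff_basis xpair_eqE eqxx /G.
  by case: ifP => _; rewrite ?mul1r ?mul0r.
- by move=> d /eqP/negPf db; rewrite /G db mulr0.
- move=> lt; rewrite /G; case: eqP => [/bnd [_]|]; last by rewrite mul0r.
  by rewrite leqNgt lt.
Qed.

(** Treats both products at once: each is the transpose of its coproduct [D], and by the bound the
    truncation at size [tag s + tag t] drops only zero coefficients. *)
Lemma mcoeff_sum_pairing (D : B -> {malg rat[(B * B)%type]}) (s t g : B) :
    (pairing << (s, t) >> (D g) != 0 -> (tag g <= tag s + tag t)%N) ->
  (\sum_(n < (tag s + tag t).+1) \sum_(h : T n)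
     pairing << (s, t) >> (D (Tagged T h)) *: << Tagged T h >>
     : {malg rat[B]})@_g
  = (D g)@_(s, t).
Proof.
move=> bnd; rewrite raddf_sum /=.
pose F h : rat := (D h)@_(s, t) * (h == g)%:R.
transitivity (F g); last by rewrite /F eqxx mulr1.
rewrite -(@sum_tagged_pick T _ (tag s + tag t).+1 F g).
- apply: eq_bigr => n _; rewrite raddf_sum /=; apply: eq_bigr => h _.
  by rewrite mcoeffZ pairing_basis mcoeff_basis.
- by move=> h /eqP/negPf hg; rewrite /F hg mulr0.
- move=> lt; rewrite /F -pairing_basis; case: eqP bnd => [->|_].
    by rewrite mul0r.
  by move=> /(_ isT); rewrite leqNgt lt.
Qed.

End TaggedSums.

Lemma mcoeff_coprod_bullet s p :
  (coprod_bullet s)@_p = (stip_cat p.1 p.2 == s)%:R.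
Proof.
exact: (@mcoeff_sum_cat (fun n => StIP n) stip_cat s p
  (fun a b => @stip_cat_bounded a b s)).
Qed.

Lemma mcoeff_coprod_square s p :
  (coprod_square s)@_p = (vinc_cat p.1 p.2 == s)%:R.
Proof.
exact: (@mcoeff_sum_cat (fun n => StIP n * 'S_n)%type vinc_cat s p
  (fun a b => @vinc_cat_bounded a b s)).
Qed.

Lemma mcoeff_prod_spade s t g : (prod_spade s t)@_g = (coprod_spade g)@_(s, t).
Proof.
exact: (@mcoeff_sum_pairing (fun n => StIP n) coprod_spade s t g
  (@coprod_spade_bounded g s t)).
Qed.

Lemma mcoeff_prod_heart s t g : (prod_heart s t)@_g = (coprod_heart g)@_(s, t).
Proof.
exact: (@mcoeff_sum_pairing (fun n => StIP n * 'S_n)%type coprod_heart s t g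
  (@coprod_heart_bounded g s t)).
Qed.

(** * Injectivity, unit, counit and coproduct *)

Lemma psi_inj : injective psi.
Proof.
move=> x y exy; apply/malgP => s.
(* The identity is an arbitrary choice: every permutation over [s] carries the coefficient of
   [s]. *)
by have := congr1 (mcoeff (Tagged _ (tagged s, 1%g) : vinc)) exy;
  rewrite !mcoeff_psi /stip_of /= taggedK.
Qed.

Lemma StIP0_eq (P : StIP 0) : P = MkIP empty_subproof.
Proof.
apply/val_inj/eqP; have /andP [pP _] := blocksP P.
rewrite -(partition_set0 (blocks P)) /=.
by have -> : set0 = [set: 'I_0] by apply/setP => -[].
Qed.

Lemma tag_stip_eq0 s : (tag s == 0%N) = (s == stip0).
Proof.
apply/eqP/eqP => [|-> //]; case: s => n P /= n0; move: P; rewrite n0 => P.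
by rewrite (StIP0_eq P).
Qed.

Lemma tag_vinc_eq0 C : (tag C == 0%N) = (C == vinc0).
Proof.
apply/eqP/eqP => [|-> //]; case: C => n [P c] /= n0; move: P c; rewrite n0 => P c.
by rewrite (StIP0_eq P); have -> : c = 1%g by apply/permP => -[].
Qed.

Lemma psi_unit : psi (hunit Hint) = hunit Hvinc.
Proof.
apply/malgP => C; rewrite mcoeff_psi !mcoeff_basis.
by rewrite eq_sym -tag_stip_eq0 [vinc0 == _]eq_sym -tag_vinc_eq0.
Qed.

Lemma psi_counit x : hcounit (psi x) = hcounit x.
Proof.
pose l : {linear hspace Hint -> rat^o} := @hcounit Hvinc \o psi.
apply: (@linear_eq_basis _ rat^o l (@hcounit Hint)) => s.
rewrite /l /= psiU hcounitU /psi_basis linear_sum /=.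
(* As [stip0] underlies [vinc0], the counit of [s] counts the permutations [g] for which [(s, g)] is
   [vinc0]. *)
rewrite eq_sym -[stip0]/(stip_of vinc0) -sum_vinc_fiber.
by apply: eq_bigr => g _; rewrite hcounitU.
Qed.

Lemma psi_coprod x : hcoprod (psi x) = tensor_map psi psi (hcoprod x).
Proof.
pose l1 : {linear _ -> _} := @hcoprod Hvinc \o psi.
pose l2 : {linear _ -> _} := tensor_map psi psi \o @hcoprod Hint.
apply: (linear_eq_basis (f := l1) (g := l2)) => s; rewrite /l1 /l2 /=.
rewrite psiU hcoprodU; apply/malgP => -[C D].
rewrite mcoeff_tensor_map_psi mcoeff_coprod_bullet /=.
(* Forgetting permutations commutes with concatenation by computation, so the fibre count applies to
   [vinc_cat C D]. *)
rewrite -[stip_cat _ _]/(stip_of (vinc_cat C D)) -sum_vinc_fiber.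
rewrite linear_sum raddf_sum; apply: eq_bigr => g _ /=.
by rewrite hcoprodU mcoeff_coprod_square eq_sym.
Qed.

(** * Compatibility with products, by duality *)

Definition forget2 :
    {linear {malg rat[(vinc * vinc)%type]} -> {malg rat[(stip * stip)%type]}} :=
  linext (fun p => << (stip_of p.1, stip_of p.2) >>).

(** This identifies [forget2] as the transpose of [tensor_map psi psi] for the pairings. *)
Lemma mcoeff_forget2 x s t :
  (forget2 x)@_(s, t) = \sum_(g : 'S_(tag s)) \sum_(h : 'S_(tag t))
    x@_(Tagged _ (tagged s, g) : vinc, Tagged _ (tagged t, h) : vinc).
Proof.
rewrite linear_basisE raddf_sum /=.
under eq_bigr => p _.
  rewrite mcoeffZ linextU mcoeff_basis xpair_eqE -mulnb natrM.
  rewrite -!sum_vinc_fiber big_distrlr mulr_sumr /=.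
  under eq_bigr => p' _ do rewrite mulr_sumr /=.
  over.
rewrite exchange_big; apply: eq_bigr => g _ /=.
rewrite exchange_big; apply: eq_bigr => h _ /=.
rewrite -[RHS]sum_msupp_delta; apply: eq_bigr => -[C D] _.
by rewrite xpair_eqE -natrM mulnb ![_ == Tagged _ _]eq_sym.
Qed.

(** The gluing condition does not involve the permutation, so both coproducts are indexed by the
    same [A], [A'], [P], [P'] and agree term by term once the permutations are dropped. *)
Lemma forget2_coprod_heart G :
  forget2 (coprod_heart G) = coprod_spade (stip_of G).
Proof.
rewrite /coprod_heart linear_sum; apply: eq_bigr => A _.
rewrite linear_sum; apply: eq_bigr => A' _.
rewrite linear_sum; apply: eq_bigr => P _.
rewrite linear_sum; apply: eq_bigr => P' _.
exact: linextU.
Qed.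

(** Transposing [forget2_coprod_heart] gives the identity on basis tensors. Stated on the whole
    tensor square, it also applies to coproducts, as the antipode argument requires. *)
Lemma psi_mul z : psi (hmul z) = hmul (tensor_map psi psi z).
Proof.
pose l1 : {linear _ -> _} := psi \o @hmul Hint.
pose l2 : {linear _ -> _} := @hmul Hvinc \o tensor_map psi psi.
apply: (linear_eq_basis (f := l1) (g := l2)) => -[s t]; rewrite /l1 /l2 /=.
rewrite hmulU; apply/malgP => G.
rewrite mcoeff_psi mcoeff_prod_spade -forget2_coprod_heart mcoeff_forget2.
rewrite tensor_mapU -[tensor _ _]/(tensor (psi << s >>) (psi << t >>)).
have psi_tensor : tensor (psi << s >>) (psi << t >>)
  = tensor (psi_basis s) (psi_basis t) by congr tensor; apply: psiU.
rewrite psi_tensor /psi_basis tensor_suml linear_sum raddf_sum; apply: eq_bigr => g _ /=.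
rewrite tensor_sumr linear_sum raddf_sum; apply: eq_bigr => h _ /=.
by rewrite tensorU hmulU mcoeff_prod_heart.
Qed.

(** * The empty element as a left unit of [Hvinc] *)

Lemma glue_set0 n (Q : {set {set 'I_n}}) :
  trivIset Q -> set0 \notin Q -> glue set0 Q = Q.
Proof.
move=> tQ nQ; rewrite /glue set0U.
(* Distinct blocks of [Q] are disjoint, so a path never leaves its first block and every class is a
   singleton. *)
have conn T X : T \in Q -> connect (meet_rel set0 Q) T X = (X == T).
  move=> TQ; apply/idP/eqP => [/connectP [p]|->]; last exact: connect0.
  elim: p T TQ => [|Y p IHp] T TQ //= /andP [/and3P [_ YQ meet] pth] eX.
  rewrite set0U in YQ; suff eY : Y = T by apply: IHp; rewrite // -eY.
  apply: contraNeq meet => YT; rewrite setI_eq0.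
  by apply: (trivIsetP tQ) => //; rewrite eq_sym.
rewrite -[RHS]imset_id; apply: eq_in_imset => T TQ.
rewrite (eq_bigl (pred1 T)) ?big_pred1_eq // => X /=.
by rewrite conn // andb_idl // => /eqP ->.
Qed.

Lemma val_enum_val_setT n (i : 'I_#|[set: 'I_n]|) : enum_val i = i :> nat.
Proof.
have lt : (i < n)%N by rewrite (leq_trans (ltn_ord i)) // cardsT card_ord.
by rewrite (enum_val_nth (Ordinal lt)) enum_setT -enumT nth_enum_ord.
Qed.

Lemma card_ltn_ord n (k : 'I_n) : #|[set i : 'I_n | (i < k)%N]| = k.
Proof.
have -> : [set i : 'I_n | (i < k)%N] = widen_ord (ltnW (ltn_ord k)) @: setT.
  apply/setP => i; rewrite inE; apply/idP/imsetP => [lt|[j _ ->]]; last exact: (ltn_ord j).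
  by exists (Ordinal lt); last exact: val_inj.
by rewrite card_imset ?cardsT ?card_ord // => i j /(congr1 val) /= /val_inj.
Qed.

Lemma st_setT n (s : 'S_n) (i : 'I_#|[set: 'I_n]|) :
  st s [set: 'I_n] i = s (enum_val i) :> nat.
Proof.
rewrite permE /= -[RHS]card_ltn_ord.
(* The positions of smaller letters are counted through their letters, which are exactly the values
   below [s (enum_val i)]. *)
rewrite -(card_imset _ (inj_comp (@perm_inj _ s) (@enum_val_inj _ _))).
apply: eq_card => k; rewrite inE; apply/imsetP/idP => [[j]|lt].
  by rewrite inE => h ->.
have kT : (s^-1)%g k \in [set: 'I_n] by rewrite inE.
by exists (enum_rank_in kT ((s^-1)%g k)); rewrite ?inE /= enum_rankK_in // permKV.
Qed.

(** For sizes such as [#|[set: 'I_n]|] and [n], equal but not convertible: the comparison goes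
    through a value-preserving [f], which avoids transporting partitions and permutations along
    [m = n]. *)
Lemma vinc_eq m n (P : StIP m) (s : 'S_m) (Q : StIP n) (t : 'S_n)
    (f : 'I_m -> 'I_n) :
  m = n -> (forall i, f i = i :> nat) ->
  blocks P = [set [set i | f i \in (B : {set 'I_n})] | B in blocks Q] ->
  (forall i, s i = t (f i) :> nat) ->
  Tagged (fun n => (StIP n * 'S_n)%type) (P, s) = Tagged _ (Q, t) :> vinc.
Proof.
move=> e; case: n / e Q t f => Q t f fE PQ st_eq.
have fid i : f i = i by apply/val_inj/fE.
have -> : s = t by apply/permP => i; apply/val_inj; rewrite /= st_eq fid.
have -> // : P = Q; apply/val_inj; rewrite /= PQ -[RHS]imset_id.
by apply: eq_imset => B; apply/setP => i; rewrite inE fid.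
Qed.

Lemma vinc_std_setT n (P : StIP n) (s : 'S_n) :
  Tagged (fun n => (StIP n * 'S_n)%type) (std P, st s [set: 'I_n])
  = Tagged _ (P, s) :> vinc.
Proof.
apply: (vinc_eq (f := fun i => enum_val i)).
- by rewrite cardsT card_ord.
- exact: val_enum_val_setT.
- by apply: eq_imset => B; apply/setP => i; rewrite !inE.
- exact: st_setT.
Qed.

Lemma IP_set0 n (P : @IP n set0) : blocks P = set0.
Proof.
by have /andP [+ _] := blocksP P; rewrite partition_set0 => /eqP.
Qed.

Lemma empty_ip_subproof n : @is_ip n set0 set0.
Proof.
by rewrite /is_ip partition_set0 eqxx; apply/forall_inP => B; rewrite inE.
Qed.

(** The left factor has size [#|A|], so only the empty [A] contributes. Then [A'] is everything, [P]
    is empty, and gluing with the empty partition forces [P'] to be the partition of [G]. *)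
Lemma mcoeff_coprod_heart_unit G x : (coprod_heart G)@_(vinc0, x) = (G == x)%:R.
Proof.
case: G => n [g c]; rewrite /coprod_heart raddf_sum /=.
rewrite (bigD1 set0) //= [X in _ + X]big1 => [|A A0]; last first.
  rewrite raddf_sum big1 // => A' _ /=; rewrite raddf_sum big1 // => P _ /=.
  rewrite raddf_sum big1 // => P' _ /=; rewrite mcoeff_basis xpair_eqE.
  by rewrite -tag_vinc_eq0 /= cards_eq0 (negPf A0).
rewrite addr0 (big_pred1 setT) => [|A]; last by rewrite /= set0U.
rewrite raddf_sum (big_pred1 (MkIP (@empty_ip_subproof n))) /=; last first.
  by move=> P; rewrite /= -val_eqE /= IP_set0 eqxx.
rewrite raddf_sum (big_pred1 g) /= => [|P]; last first.
  have /andP [/and3P [_ tP nP] _] := blocksP P.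
  by rewrite /= glue_set0.
rewrite mcoeff_basis xpair_eqE vinc_std_setT -tag_vinc_eq0 /= cards0.
by [].
Qed.

Lemma prod_heart_unit x : prod_heart vinc0 x = << x >>.
Proof.
apply/malgP => G.
by rewrite mcoeff_prod_heart mcoeff_coprod_heart_unit mcoeff_basis eq_sym.
Qed.

Lemma hmul_unit y : hmul (tensor (hunit Hvinc) y) = y.
Proof.
rewrite [tensor _ y]tensor_basisE msuppU oner_eq0 big_seq_fset1 mcoeffUU.
rewrite linear_sum [RHS]malg_basisE; apply: eq_bigr => C _.
by rewrite linearZ /= tensorU mul1r (hmulU (H := Hvinc)) /= prod_heart_unit.
Qed.

(** * Compatibility with antipodes *)

Lemma stip_cat0 s : stip_cat stip0 s = s.
Proof.
case: s => n P; congr (existT _ n _); apply/val_inj => /=.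
rewrite imset0 set0U -[RHS]imset_id; apply: eq_imset => B.
rewrite -[RHS]imset_id; apply: eq_imset => i; exact: val_inj.
Qed.

(** Meant for the difference [D] of two right convolution inverses of [psi]. *)
Lemma convolution_psi_eq0 (D : {linear hspace Hint -> hspace Hvinc}) :
  (forall x, hmul (tensor_map psi D (hcoprod x)) = 0) -> forall x, D x = 0.
Proof.
move=> psiD; suff D0 (s : stip) : D << s >> = 0.
  by move=> x; rewrite linear_basisE big1 // => s _; rewrite D0 scaler0.
have [N] := ubnP (tag s); elim: N s => // N IHN s /ltnSE le_sN.
have := psiD << s >>; rewrite hcoprodU.
rewrite (linear_basisE (tensor_map psi D)) linear_sum /=.
set d := coprod_bullet s.
have sd : (stip0, s) \in msupp d.
  by rewrite -mcoeff_neq0 mcoeff_coprod_bullet stip_cat0 eqxx oner_eq0.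
rewrite (big_fsetD1 _ sd) /= big1_seq => [|[a b] /andP [_]].
  rewrite addr0 mcoeff_coprod_bullet stip_cat0 eqxx scale1r tensor_mapU /=.
  by rewrite psi_unit hmul_unit.
rewrite !inE xpair_eqE -mcoeff_neq0 mcoeff_coprod_bullet /= => /andP [ne].
have [abs _|_] := stip_cat a b =P s; last by rewrite eqxx.
(* With [a] empty, [b] would be [s], and this pair has been split off. Hence [b] is strictly smaller
   than [s] and the induction hypothesis kills the term. *)
have a_gt0 : (0 < tag a)%N.
  rewrite lt0n tag_stip_eq0; apply: contraNneq ne => a0.
  by rewrite -abs a0 stip_cat0 !eqxx.
have lt_bs : (tag b < tag s)%N by rewrite -abs /= -[ltnLHS]add0n ltn_add2r.
rewrite linearZ /= tensor_mapU /= (IHN b) ?(leq_trans lt_bs) //.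
by rewrite tensorr0 linear0 scaler0.
Qed.

Lemma psi_antipode S T : is_antipode S -> is_antipode T ->
  forall x, psi (S x) = T (psi x).
Proof.
move=> antiS antiT x; apply/eqP; rewrite -subr_eq0; apply/eqP.
pose D : {linear hspace Hint -> hspace Hvinc} := (psi \o S) \- (T \o psi).
apply: (@convolution_psi_eq0 D) => {}x.
have -> : tensor_map psi D (hcoprod x) = tensor_map psi (psi \o S) (hcoprod x)
    - tensor_map psi (T \o psi) (hcoprod x).
  pose l : {linear _ -> _} :=
    tensor_map psi (psi \o S) \- tensor_map psi (T \o psi).
  apply: (linear_eq_basis (f := tensor_map psi D) (g := l)) => p.
  by rewrite /l /= !tensor_mapU tensorBr.
(* The first convolution is [psi] applied to the one of [idfun] with [S]; the second is the one of
   [idfun] with [T], evaluated at [psi x]. Both equal the counit of [x] times the unit. *)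
rewrite linearB /= -(tensor_map_comp psi psi idfun S).
rewrite -(tensor_map_comp idfun T psi psi) -psi_mul -psi_coprod.
rewrite (antiS x).2 (antiT (psi x)).2 linearZ /= psi_unit psi_counit.
exact: subrr.
Qed.

Theorem proposition4p14 : @hopf_morphism Hint Hvinc psi /\ injective psi.
Proof.
split; last exact: psi_inj.
split.
- exact: psi_unit.
- by move=> x y; rewrite /hprod psi_mul tensor_map_tensor.
- exact: psi_counit.
- exact: psi_coprod.
- exact: psi_antipode.
Qed.
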